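(* Let $f$ be a regular octonionic polynomial of degree $n>0$. Then its zero set $V(f)$ is non-empty and the number $k$ of distinct conjugacy classes of elements of $V(f)$ is less than or equal to $n$. More precisely, if $\alpha_1,\ldots,\alpha_r$ are the distinct real zeros of $f$, $\alpha_{r+1},\ldots,\alpha_{r+i}$ are the distinct isolated zeros of $f$, and $\alpha_{r+i+1},\ldots,\alpha_{r+i+s}$ are pairwise non-conjugate spherical zeros of $f$ such that $\bigcup_{j=1}^s\mathbb{S}_{\alpha_{r+i+j}}$ is the set of all spherical zeros of $f$, then $k=r+i+s$ and $$\sum_{j=1}^k m_f(\alpha_j)=n.$$ In particular, $r+i+2s\le n$.
   Context: $\mathbb{O}$ is the real alternative division algebra of octonions (an octonion is non-real if it is not in $\mathbb{R}$), $\overline{x}$ is octonionic conjugation, $|x|$ the norm. A regular octonionic polynomial of degree $n$ is a function $f:\mathbb{O}\to\mathbb{O}$, $f(w)=\sum_{i=0}^n w^i a_i$ with $a_i\in\mathbb{O}$, $a_n\ne0$. For two such polynomials (or everywhere convergent power series) $f=\sum_i w^ia_i$, $g=\sum_j w^jb_j$, put $(f\ast g)(w)=\sum_k w^k\big(\sum_{i+j=k}a_ib_j\big)$, $\overline f(w)=\sum_i w^i\overline{a}_i$, and $N(f)=f\ast\overline f=\overline f\ast f$, which has real coefficients. For $\alpha\in\mathbb{O}$ put $\Delta_\alpha(w)=w^2-w(\alpha+\overline\alpha)+|\alpha|^2$, a real polynomial. $\mathbb{S}_\alpha=\{\mathrm{Re}(\alpha)+|\mathrm{Im}(\alpha)|\,I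 : I\in\mathbb{O},\ I^2=-1\}$ is the conjugacy class of $\alpha$ ($\mathbb{S}_\alpha=\{\alpha\}$ if $\alpha$ is real); $\Delta_\alpha=\Delta_\beta$ iff $\beta\in\mathbb{S}_\alpha$. $V(f)$ is the zero set of $f$. A real $\alpha\in V(f)$ is a real zero of $f$. A non-real $\alpha$ with $\mathbb{S}_\alpha\subset V(f)$ is a spherical zero of $f$; a non-real $\alpha\in V(f)$ with $\mathbb{S}_\alpha\not\subset V(f)$ is an isolated zero of $f$. For $\alpha\in V(f)$, the multiplicity $m_f(\alpha)$ is the integer $s\ge 0$ such that $\Delta_\alpha^s\mid N(f)$ and $\Delta_\alpha^{s+1}\nmid N(f)$. *)

(* Defs.v *)
From HB Require Import structures.
From mathcomp Require Import all_boot all_order all_algebra.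
From mathcomp Require Import ring lra zify.
From mathcomp Require Import boolp classical_sets functions cardinality reals.
Set Implicit Arguments.
Unset Strict Implicit.
Unset Printing Implicit Defensive.
Import Order.TTheory GRing.Theory Num.Theory.
Local Open Scope ring_scope.
Local Open Scope classical_set_scope.

(* Cayley-Dickson doubling, with the convention
   (a, b)(c, d) = (ac - d^* b, da + b c^* ) and (a, b)^* = (a^*, - b). *)
Definition cd_mul (V : zmodType) (mul : V -> V -> V) (conj : V -> V)
    (x y : V * V) : V * V :=
  (mul x.1 y.1 - mul (conj y.2) x.2, mul y.2 x.1 + mul x.2 (conj y.1)).

Definition cd_conj (V : zmodType) (conj : V -> V) (x : V * V) : V * V :=
  (conj x.1, - x.2).

Section Octonions.
Variable R : realType.

Local Notation C := (R^o * R^o)%type.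
Local Notation H := (C * C)%type.

Definition cmul : C -> C -> C := @cd_mul R^o *%R id.
Definition cconj : C -> C := @cd_conj R^o id.
Definition hmul : H -> H -> H := cd_mul cmul cconj.
Definition hconj : H -> H := cd_conj cconj.

(* The product of octonions is omul; the componentwise ring product that the
   library puts on pairs is never used on oct. *)
Definition oct : Type := H * H.
HB.instance Definition _ := GRing.Lmodule.on oct.

Definition omul : oct -> oct -> oct := cd_mul hmul hconj.
Definition oconj : oct -> oct := cd_conj hconj.
Definition octR (r : R) : oct := ((((r, 0), 0), 0) : H * H).
Definition ore (x : oct) : R := x.1.1.1.
Definition oim (x : oct) : oct := x - octR (ore x).

Definition onorm (x : oct) : R :=
  let sq2 (c : C) := c.1 ^+ 2 + c.2 ^+ 2 in
  let sq4 (h : H) := sq2 h.1 + sq2 h.2 in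
  Num.sqrt (sq4 x.1 + sq4 x.2).

Definition opow (w : oct) (i : nat) : oct := iter i (omul w) (octR 1).

Definition oct_real : set oct := range octR.

Definition conj_class (a : oct) : set oct :=
  [set x | exists I : oct,
     omul I I = - octR 1 /\ x = octR (ore a) + onorm (oim a) *: I].

(* A regular polynomial is given by its sequence f of coefficients, which it
   determines (restrict the function to the real line). *)
Definition has_degree (f : seq oct) (n : nat) : Prop :=
  size f = n.+1 /\ f`_n <> 0.

Definition oeval (f : seq oct) (w : oct) : oct :=
  \sum_(i < size f) omul (opow w i) f`_i.

Definition ostar (f g : seq oct) : seq oct :=
  mkseq (fun k => \sum_(i < k.+1) omul f`_i g`_(k - i)) (size f + size g).-1.

Definition pconj (f : seq oct) : seq oct := map oconj f.

(* N(f) as a real polynomial: nth_ostar_pconj below shows that taking real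
   parts of the coefficients loses nothing. *)
Definition Npoly (f : seq oct) : {poly R} := Poly (map ore (ostar f (pconj f))).

Definition Delta (a : oct) : {poly R} :=
  'X^2 - ore (a + oconj a) *: 'X + (onorm a ^+ 2)%:P.

Definition is_mult (f : seq oct) (a : oct) (s : nat) : Prop :=
  Delta a ^+ s %| Npoly f /\ ~ (Delta a ^+ s.+1 %| Npoly f).

(* "The" s such that is_mult f a s; see is_mult_uniq and multP. *)
Definition mult (f : seq oct) (a : oct) : nat := xget 0%N (is_mult f a).

Definition zeros (f : seq oct) : set oct := [set w | oeval f w = 0].

Definition real_zeros (f : seq oct) : set oct := zeros f `&` oct_real.

Definition spherical_zeros (f : seq oct) : set oct :=
  [set a | ~ oct_real a /\ conj_class a `<=` zeros f].

Definition isolated_zeros (f : seq oct) : set oct :=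
  [set a | [/\ ~ oct_real a, zeros f a & ~ (conj_class a `<=` zeros f)]].

Record zero_listing (f rs us ss : seq oct) : Prop := ZeroListing {
  listing_real_uniq : uniq rs;
  listing_real : [set` rs] = real_zeros f;
  listing_isolated_uniq : uniq us;
  listing_isolated : [set` us] = isolated_zeros f;
  listing_spherical_sub : [set` ss] `<=` spherical_zeros f;
  listing_spherical_nonconj : pairwise (fun a b => b \notin conj_class a) ss;
  listing_spherical : \bigcup_(a in [set` ss]) conj_class a = spherical_zeros f
}.

Lemma oct_ext (x y : oct) :
  [/\ x.1.1.1 = y.1.1.1, x.1.1.2 = y.1.1.2, x.1.2.1 = y.1.2.1
    & x.1.2.2 = y.1.2.2] ->
  [/\ x.2.1.1 = y.2.1.1, x.2.1.2 = y.2.1.2, x.2.2.1 = y.2.2.1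
    & x.2.2.2 = y.2.2.2] -> x = y.
Proof.
case: x => [[[x0 x1] [x2 x3]] [[x4 x5] [x6 x7]]].
case: y => [[[y0 y1] [y2 y3]] [[y4 y5] [y6 y7]]].
by move=> /= [-> -> -> ->] [-> -> -> ->].
Qed.

Local Ltac oct_ring := apply: oct_ext; split; rewrite /=; ring.

Lemma omul1o x : omul (octR 1) x = x.
Proof. by case: x => [[[x0 x1] [x2 x3]] [[x4 x5] [x6 x7]]]; oct_ring. Qed.

Lemma omulo1 x : omul x (octR 1) = x.
Proof. by case: x => [[[x0 x1] [x2 x3]] [[x4 x5] [x6 x7]]]; oct_ring. Qed.

Lemma omul_altl x y : omul x (omul x y) = omul (omul x x) y.
Proof.
case: x => [[[x0 x1] [x2 x3]] [[x4 x5] [x6 x7]]].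
by case: y => [[[y0 y1] [y2 y3]] [[y4 y5] [y6 y7]]]; oct_ring.
Qed.

Lemma omul_altr x y : omul (omul y x) x = omul y (omul x x).
Proof.
case: x => [[[x0 x1] [x2 x3]] [[x4 x5] [x6 x7]]].
by case: y => [[[y0 y1] [y2 y3]] [[y4 y5] [y6 y7]]]; oct_ring.
Qed.

Lemma oconjK : involutive oconj.
Proof. by case=> [[[x0 x1] [x2 x3]] [[x4 x5] [x6 x7]]]; oct_ring. Qed.

Lemma oconjM x y : oconj (omul x y) = omul (oconj y) (oconj x).
Proof.
case: x => [[[x0 x1] [x2 x3]] [[x4 x5] [x6 x7]]].
by case: y => [[[y0 y1] [y2 y3]] [[y4 y5] [y6 y7]]]; oct_ring.
Qed.

Lemma oconjD x y : oconj (x + y) = oconj x + oconj y.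
Proof.
case: x => [[[x0 x1] [x2 x3]] [[x4 x5] [x6 x7]]].
by case: y => [[[y0 y1] [y2 y3]] [[y4 y5] [y6 y7]]]; oct_ring.
Qed.

Lemma oconj0 : oconj 0 = 0.
Proof. by oct_ring. Qed.

Lemma omul0o x : omul 0 x = 0.
Proof. by case: x => [[[x0 x1] [x2 x3]] [[x4 x5] [x6 x7]]]; oct_ring. Qed.

Lemma omulo0 x : omul x 0 = 0.
Proof. by case: x => [[[x0 x1] [x2 x3]] [[x4 x5] [x6 x7]]]; oct_ring. Qed.

Lemma oconj_id x : oconj x = x -> x = octR (ore x).
Proof.
case: x => [[[x0 x1] [x2 x3]] [[x4 x5] [x6 x7]]] [].
by move=> h1 h2 h3 h4 h5 h6 h7; apply: oct_ext; split => //=; lra.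
Qed.

Lemma onorm_sqr x : onorm x ^+ 2 = ore (omul x (oconj x)).
Proof.
rewrite sqr_sqrtr ?addr_ge0 ?sqr_ge0//.
by case: x => [[[x0 x1] [x2 x3]] [[x4 x5] [x6 x7]]] /=; rewrite /ore /=; ring.
Qed.

Lemma omul_oconj x : omul x (oconj x) = octR (onorm x ^+ 2).
Proof. by rewrite onorm_sqr; apply: oconj_id; rewrite oconjM oconjK. Qed.

Lemma onorm_eq0 x : onorm x = 0 -> x = 0.
Proof.
move=> /(congr1 (fun r => r ^+ 2)); rewrite expr0n sqr_sqrtr => /=; last first.
  by rewrite !addr_ge0 ?sqr_ge0.
case: x => [[[x0 x1] [x2 x3]] [[x4 x5] [x6 x7]]] /= /eqP.
rewrite !paddr_eq0 ?addr_ge0 ?sqr_ge0// !sqrf_eq0.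
move=> /andP[/andP[/andP[/eqP-> /eqP->] /andP[/eqP-> /eqP->]]].
by move=> /andP[/andP[/eqP-> /eqP->] /andP[/eqP-> /eqP->]].
Qed.

Lemma nth_ostar f g k : (ostar f g)`_k = \sum_(i < k.+1) omul f`_i g`_(k - i).
Proof.
rewrite /ostar; have [kn|nk] := ltnP k (size f + size g).-1.
  by rewrite nth_mkseq.
rewrite nth_default ?size_mkseq// big1// => i _.
have [fi|fi] := leqP (size f) i; first by rewrite nth_default ?omul0o.
rewrite [g`__]nth_default ?omulo0//; case: i fi => i /= ik fi; lia.
Qed.

Lemma nth_pconj f k : (pconj f)`_k = oconj f`_k.
Proof.
have [kf|fk] := ltnP k (size f); first by rewrite (nth_map 0).
by rewrite !nth_default ?oconj0 ?size_map.
Qed.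

Lemma coef_Npoly f k : (Npoly f)`_k = ore (ostar f (pconj f))`_k.
Proof.
rewrite coef_Poly; have [kf|fk] := ltnP k (size (ostar f (pconj f))).
  by rewrite (nth_map 0).
by rewrite [in RHS]nth_default// nth_default// size_map.
Qed.

Lemma nth_ostar_pconj f k : (ostar f (pconj f))`_k = octR (Npoly f)`_k.
Proof.
rewrite coef_Npoly; apply: oconj_id; rewrite nth_ostar.
rewrite (big_morph _ oconjD oconj0) (reindex_inj rev_ord_inj) /=.
apply: eq_bigr => -[i ik] _ /=; rewrite oconjM !nth_pconj oconjK subSS.
by rewrite subKn.
Qed.

Lemma Npoly_neq0 f n : has_degree f n -> Npoly f != 0.
Proof.
move=> [sf fn0]; apply/eqP => N0.
have := coef_Npoly f n.*2; rewrite N0 coef0 nth_ostar.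
have lt_n : (n < n.*2.+1)%N by rewrite ltnS -addnn leq_addr.
rewrite (bigD1 (Ordinal lt_n)) //= big1 ?addr0; last first.
  move=> [i ilt] /eqP /= ne_in; have {}ne_in : i <> n.
    by move=> e; apply: ne_in; apply: val_inj.
  have [gt|le] := ltnP n i; first by rewrite nth_default ?omul0o// sf.
  by rewrite [X in omul _ X]nth_default ?omulo0// size_map sf; lia.
rewrite nth_pconj -[X in _`_(X - _)]addnn addnK -onorm_sqr => /esym/eqP.
by rewrite sqrf_eq0 => /eqP/onorm_eq0.
Qed.

Lemma size_Delta a : size (Delta a) = 3.
Proof.
rewrite /Delta -addrA size_polyDl ?size_polyXn//.
apply: (leq_ltn_trans (size_polyD _ _)); rewrite gtn_max size_polyN.
rewrite (leq_ltn_trans (size_scale_leq _ _)) ?size_polyX//=.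
by rewrite (leq_ltn_trans (size_polyC_leq1 _)).
Qed.

Lemma is_mult_uniq f a s t : is_mult f a s -> is_mult f a t -> s = t.
Proof.
move=> [s1 s2] [t1 t2]; apply/eqP; rewrite eqn_leq; apply/andP.
by split; rewrite leqNgt; apply/negP => lt_st;
  [apply: t2; apply: dvdp_trans s1|apply: s2; apply: dvdp_trans t1];
  apply: dvdp_exp2l.
Qed.

Lemma multP f n a : has_degree f n -> is_mult f a (mult f a).
Proof.
move=> /Npoly_neq0 N0; apply: (@xgetPex _ 0%N (is_mult f a)).
have ex : exists s, Delta a ^+ s %| Npoly f by exists 0%N; rewrite expr0 dvd1p.
have ub s : Delta a ^+ s %| Npoly f -> (s <= size (Npoly f))%N.
  move=> /(dvdp_leq N0); apply: leq_trans; apply: leq_trans (leq_pred _).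
  by rewrite size_exp size_Delta leq_pmull.
case: (ex_maxnP ex ub) => s s1 smax; exists s; split => // /smax.
by rewrite ltnn.
Qed.

End Octonions.

(* Main.v *)
Require Import Defs.
From mathcomp Require Import all_boot all_order all_algebra.
From mathcomp Require Import ring lra zify.
From mathcomp Require Import complex polyrcf.
From mathcomp Require Import boolp classical_sets functions cardinality reals.
Import Order.TTheory GRing.Theory Num.Theory.
Local Open Scope ring_scope.
Local Open Scope classical_set_scope.
Local Open Scope card_scope.

(* Every w in the class of a satisfies w^2 = 2 Re(a) w - |a|^2, so on that class
   f is the affine map w |-> wA + B, where A and B are read off f modulo Delta_a.
   As O is a division algebra, f has no, exactly one, or only zeros in the class.
   The real coordinates F_e of f satisfy N(f) = sum_e F_e^2, and reducing this
   modulo Delta_a shows that Delta_a divides N(f) iff |B| = |a||A| and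
   <A, B> = - Re(a)|A|^2, that is, iff the class contains a zero; if it is
   spherical, Delta_a divides every F_e, hence Delta_a^2 divides N(f).  Finally
   N(f) is nonnegative on the real line and has degree 2n, so it is a constant
   times a product of n polynomials Delta_b, which are coprime or equal:
   multiplicities count the factors in each class. *)

Section Octonions.
Variable R : realType.
Implicit Types (x y z a b w : oct R) (r : R) (f L : seq (oct R))
  (P Q : {poly R}).

(** * Octonion arithmetic: bilinearity, norm, division *)

Ltac octs :=
  repeat match goal with x : oct _ |- _ => case: x => [[[? ?] [? ?]] [[? ?] [? ?]]] end.
Ltac oct_ring := intros; octs; apply: oct_ext; split; rewrite /= /GRing.scale /=; ring.

Lemma omulDl x y z : omul (x + y) z = omul x z + omul y z.
Proof. oct_ring. Qed.

Lemma omulDr x y z : omul x (y + z) = omul x y + omul x z.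
Proof. oct_ring. Qed.

Lemma omulZl r x y : omul (r *: x) y = r *: omul x y.
Proof. oct_ring. Qed.

Lemma omulZr r x y : omul x (r *: y) = r *: omul x y.
Proof. oct_ring. Qed.

(** Right division survives without associativity; this is what solves [omul w A = - B] for [w]. *)
Lemma omulK x y : omul (omul x y) (oconj y) = onorm y ^+ 2 *: x.
Proof.
rewrite onorm_sqr; octs; apply: oct_ext; split; rewrite /= /GRing.scale /ore /=; ring.
Qed.

Lemma oreD x y : ore (x + y) = ore x + ore y. Proof. by []. Qed.

Lemma oreZ r x : ore (r *: x) = r * ore x. Proof. by []. Qed.

Lemma oreR r : ore (octR r) = r. Proof. by []. Qed.

Lemma ore_oconj x : ore (oconj x) = ore x. Proof. by []. Qed.

Lemma ore_mul_conj_mul x y : ore (omul y (oconj (omul x y))) = ore x * onorm y ^+ 2.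
Proof. rewrite onorm_sqr; octs; rewrite /ore /=; ring. Qed.

Lemma ore_mul_oconjN x y : ore (omul x (oconj (- y))) = - ore (omul x (oconj y)).
Proof. octs; rewrite /ore /=; ring. Qed.

Lemma onormM x y : onorm (omul x y) ^+ 2 = onorm x ^+ 2 * onorm y ^+ 2.
Proof. rewrite !onorm_sqr; octs; rewrite /ore /=; ring. Qed.

Lemma onormZ r x : onorm (r *: x) ^+ 2 = r ^+ 2 * onorm x ^+ 2.
Proof. rewrite !onorm_sqr; octs; rewrite /ore /= /GRing.scale /=; ring. Qed.

Lemma onorm_oconj x : onorm (oconj x) = onorm x.
Proof. by rewrite /onorm; octs; rewrite /= !sqrrN. Qed.

Lemma onormN x : onorm (- x) = onorm x.
Proof. by rewrite /onorm; octs; rewrite /= !sqrrN. Qed.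

Lemma onorm_ge0 x : 0 <= onorm x.
Proof. exact: sqrtr_ge0. Qed.

Lemma onorm_eq x y : onorm x ^+ 2 = onorm y ^+ 2 -> onorm x = onorm y.
Proof.
by move=> xy; apply/eqP; rewrite -(@eqrXn2 _ 2) ?onorm_ge0//; apply/eqP.
Qed.

Lemma omul_self x : omul x x = (2 * ore x) *: x - octR (onorm x ^+ 2).
Proof.
by rewrite onorm_sqr; octs; apply: oct_ext; split; rewrite /= /GRing.scale /ore /=; ring.
Qed.

Lemma onorm_re_im x : onorm x ^+ 2 = ore x ^+ 2 + onorm (oim x) ^+ 2.
Proof. rewrite !onorm_sqr /oim; octs; rewrite /ore /=; ring. Qed.

Lemma octRE r : octR r = r *: octR 1.
Proof. oct_ring. Qed.

Lemma oct_re_im x : x = octR (ore x) + oim x.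
Proof. by rewrite /oim addrC subrK. Qed.

Lemma ore_oim x : ore (oim x) = 0.
Proof. by rewrite /oim /ore /= subrr. Qed.

Lemma onorm_octR r : onorm (octR r) ^+ 2 = r ^+ 2.
Proof. by rewrite onorm_sqr /ore /=; ring. Qed.

Lemma omul_eq0 x y : omul x y = 0 -> x = 0 \/ y = 0.
Proof.
move=> /(congr1 (fun z => onorm z ^+ 2)); rewrite onormM.
have -> : onorm (0 : oct R) ^+ 2 = 0 by rewrite onorm_sqr omul0o.
move/eqP; rewrite mulf_eq0 !sqrf_eq0 => /orP[] /eqP/onorm_eq0 ->; by [left|right].
Qed.

(** * Conjugacy classes and their characteristic polynomials *)

(** Multiplicativity of the norm gives $|x|^4 = 1$; the quadratic equation [omul_self] then leaves
    $2\,\mathrm{Re}(x)\,x = 0$ with $x \neq 0$. *)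
Lemma imaginary_unit_re_norm x :
  omul x x = - octR 1 -> ore x = 0 /\ onorm x ^+ 2 = 1.
Proof.
move=> xx; have n1 : onorm x ^+ 2 = 1.
  have := congr1 (fun z => onorm z ^+ 2) xx.
  rewrite onormM onormN onorm_octR expr1n -expr2 => /eqP.
  by rewrite sqrf_eq1 => /orP[] /eqP // h; have := sqr_ge0 (onorm x); rewrite h ler0N1.
split=> //; move: xx; rewrite omul_self n1 -[RHS]add0r => /addIr /eqP.
rewrite scaler_eq0 mulf_eq0 pnatr_eq0 /= => /orP[/eqP//|/eqP x0].
by move: n1; rewrite x0 onorm_sqr omul0o /ore /= => /esym/eqP; rewrite oner_eq0.
Qed.

Lemma conj_classP a b :
  conj_class a b <-> ore b = ore a /\ onorm b ^+ 2 = onorm a ^+ 2.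
Proof.
split=> [[I [/imaginary_unit_re_norm[I0 I1] ->]]|[re_ab n_ab]].
  have re : ore (octR (ore a) + onorm (oim a) *: I) = ore a.
    by rewrite oreD oreR oreZ I0 mulr0 addr0.
  split=> //; rewrite onorm_re_im re [RHS]onorm_re_im; congr (_ + _).
  by rewrite /oim re addrC addKr onormZ I1 mulr1.
have im_ab : onorm (oim a) = onorm (oim b).
  apply: onorm_eq; move: n_ab; rewrite onorm_re_im [RHS]onorm_re_im re_ab.
  by move=> /addrI ->.
have [m0|m0] := eqVneq (onorm (oim b)) 0.
  (* The class is a real point: the unit is multiplied by 0, so any imaginary unit serves. *)
  exists ((((0, 1), 0), 0) : oct R); split; first by oct_ring.
  by rewrite im_ab m0 scale0r addr0 -re_ab {1}(oct_re_im b) (onorm_eq0 m0) addr0.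
exists ((onorm (oim b))^-1 *: oim b); split.
  rewrite omulZl omulZr omul_self ore_oim mulr0 scale0r sub0r !scalerN.
  by rewrite octRE !scalerA -expr2 exprVn mulVf ?scale1r// expf_neq0.
by rewrite im_ab scalerA divff// scale1r -re_ab -oct_re_im.
Qed.

Lemma coef_Delta a :
  [/\ (Delta a)`_0 = onorm a ^+ 2, (Delta a)`_1 = - (2 * ore a)
    & (Delta a)`_2 = 1].
Proof.
rewrite /Delta !coefE /= oreD ore_oconj; split; ring.
Qed.

Lemma DeltaE a : Delta a = 'X^2 - (2 * ore a) *: 'X + (onorm a ^+ 2)%:P.
Proof. by rewrite /Delta oreD ore_oconj mulr_natl. Qed.

Lemma eq_Delta a b :
  Delta a = Delta b <-> ore a = ore b /\ onorm a ^+ 2 = onorm b ^+ 2.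
Proof.
split=> [ab|[re n]]; last by rewrite !DeltaE re n.
have [a0 a1 _] := coef_Delta a; have [b0 b1 _] := coef_Delta b.
split; last by rewrite -a0 ab b0.
by apply: (@mulfI _ 2); rewrite ?pnatr_eq0//; apply: oppr_inj; rewrite -a1 ab b1.
Qed.

Lemma conj_class_Delta a b : conj_class a b <-> Delta b = Delta a.
Proof. by rewrite conj_classP eq_Delta. Qed.

Lemma eq_conj_class a b : conj_class a = conj_class b <-> Delta a = Delta b.
Proof.
split=> [ab|ab]; first by apply/conj_class_Delta; rewrite -ab conj_class_Delta.
by apply/seteqP; split=> x; rewrite !conj_class_Delta ab.
Qed.

Lemma monic_Delta a : Delta a \is monic.
Proof. by rewrite monicE lead_coefE size_Delta; have [_ _ ->] := coef_Delta a. Qed.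

Lemma Delta_neq0 a : Delta a != 0.
Proof. exact: monic_neq0 (monic_Delta a). Qed.

Lemma Delta_horner a (r : R) : (Delta a).[r] = (r - ore a) ^+ 2 + onorm (oim a) ^+ 2.
Proof. rewrite DeltaE !hornerE onorm_re_im; ring. Qed.

(** On the real line [Delta a] is a sum of two squares, so a real root forces $\mathrm{Im}(a) =
    0$. *)
Lemma root_Delta a (r : R) : root (Delta a) r -> a = octR r.
Proof.
rewrite /root Delta_horner paddr_eq0 ?sqr_ge0// !sqrf_eq0 subr_eq0.
by move=> /andP[/eqP-> /eqP/onorm_eq0 m0]; rewrite {1}(oct_re_im a) m0 addr0.
Qed.

(** One Euclidean step suffices: the difference of two monic quadratics is a nonzero constant or has
    degree 1. In the latter case a common factor would give a common real root, and [root_Delta]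
    would make [a] and [b] equal. *)
Lemma coprimep_Delta a b : Delta a != Delta b -> coprimep (Delta a) (Delta b).
Proof.
move=> ab; set D := Delta a - Delta b.
suff : coprimep (Delta a) D.
  have -> : D = 1 * Delta a + - Delta b by rewrite mul1r.
  by rewrite coprimep_addl_mul -scaleN1r coprimepZr ?oppr_eq0 ?oner_eq0.
have DE : D = (2 * (ore b - ore a)) *: 'X + (onorm a ^+ 2 - onorm b ^+ 2)%:P.
  by rewrite /D !DeltaE -!mul_polyC; ring.
have D0 : D != 0 by rewrite subr_eq0.
have [re|re] := eqVneq (ore b) (ore a).
  move: DE D0; rewrite re subrr mulr0 scale0r add0r => ->; rewrite polyC_eq0 => h.
  by rewrite -alg_polyC coprimepZr ?coprimep1.
set c := 2 * (ore b - ore a) in DE; set e := (_ - _ : R) in DE.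
have c0 : c != 0 by rewrite mulf_neq0 ?pnatr_eq0 ?subr_eq0.
have {}DE : D = c *: ('X - (- e / c)%:P).
  by rewrite scalerBr scale_polyC mulrC divfK// polyCN opprK.
rewrite DE coprimepZr // coprimep_XsubC; apply/negP => ra.
have rb : root (Delta b) (- e / c).
  have : root D (- e / c) by rewrite DE rootZ// root_XsubC.
  by rewrite /root /D hornerD hornerN (eqP ra) sub0r oppr_eq0.
by move: ab; rewrite (root_Delta _ _ ra) (root_Delta _ _ rb) eqxx.
Qed.

(** * Real coordinates of f, N(f) as a sum of squares, and remainders *)

Definition ocoord (e : 'I_8) x : R :=
  [:: x.1.1.1; x.1.1.2; x.1.2.1; x.1.2.2; x.2.1.1; x.2.1.2; x.2.2.1; x.2.2.2]`_e.

Lemma ocoordD e x y : ocoord e (x + y) = ocoord e x + ocoord e y.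
Proof. by case: e => -[|[|[|[|[|[|[|[|[]]]]]]]]]. Qed.

Lemma ocoordZ e r x : ocoord e (r *: x) = r * ocoord e x.
Proof. by case: e => -[|[|[|[|[|[|[|[|[]]]]]]]]]. Qed.

Lemma ocoord0 e : ocoord e 0 = 0.
Proof. by rewrite -(scale0r 0) ocoordZ mul0r. Qed.

Lemma ocoord_sum e (I : Type) (s : seq I) (F : I -> oct R) :
  ocoord e (\sum_(i <- s) F i) = \sum_(i <- s) ocoord e (F i).
Proof. exact: (big_morph _ (ocoordD e) (ocoord0 e)). Qed.

Lemma ore_omul_oconj x y :
  ore (omul x (oconj y)) = \sum_(e < 8) ocoord e x * ocoord e y.
Proof.
rewrite !big_ord_recl big_ord0 /ocoord /=; octs; rewrite /ore /=; ring.
Qed.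

Definition coord_poly (f : seq (oct R)) (e : 'I_8) : {poly R} :=
  \poly_(i < size f) ocoord e f`_i.

Lemma coef_coord_poly f e i : (coord_poly f e)`_i = ocoord e f`_i.
Proof. by rewrite coef_poly; case: ltnP => // h; rewrite nth_default ?ocoord0. Qed.

(** The real part of $x\overline{y}$ is the Euclidean inner product, so each coefficient of N(f) is
    a sum over the coordinates of ordinary Cauchy products. *)
Lemma NpolyE f : Npoly f = \sum_(e < 8) coord_poly f e ^+ 2.
Proof.
apply/polyP => k; rewrite coef_Npoly nth_ostar coef_sum.
rewrite (big_morph _ oreD (erefl : ore 0 = 0)).
under eq_bigr do rewrite nth_pconj ore_omul_oconj.
rewrite exchange_big /=; apply: eq_bigr => e _; rewrite expr2 coefM.
by apply: eq_bigr => i _; rewrite !coef_coord_poly.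
Qed.

Lemma horner_Npoly_ge0 f (r : R) : 0 <= (Npoly f).[r].
Proof.
by rewrite NpolyE horner_sum sumr_ge0// => e _; rewrite horner_exp sqr_ge0.
Qed.

Lemma size_Npoly f n : has_degree f n -> size (Npoly f) = (2 * n).+1.
Proof.
move=> [sf fn0]; apply/eqP; rewrite eqn_leq; apply/andP; split.
  apply: leq_trans (size_Poly _) _.
  by rewrite size_map size_mkseq size_map sf; lia.
suff N2n : (Npoly f)`_(2 * n) != 0.
  by apply: contraR N2n; rewrite -leqNgt => /leq_sizeP->.
rewrite coef_Npoly nth_ostar.
have lt_n : (n < (2 * n).+1)%N by lia.
rewrite (bigD1 (Ordinal lt_n)) //= big1 ?addr0; last first.
  move=> [i ilt] /eqP /= ne_in; have {}ne_in : i <> n.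
    by move=> e; apply: ne_in; apply: val_inj.
  have [gt|le] := ltnP n i; first by rewrite nth_default ?omul0o// sf.
  by rewrite [X in omul _ X]nth_default ?omulo0// size_map sf; lia.
have -> : (2 * n - n = n)%N by lia.
by rewrite nth_pconj -onorm_sqr sqrf_eq0; apply/eqP => /onorm_eq0.
Qed.

(* On the class with characteristic polynomial [D], [f] agrees with
   [w |-> omul w (rem_coef f D 1) + rem_coef f D 0]. *)
Definition rem_coef (f : seq (oct R)) (D : {poly R}) (j : nat) : oct R :=
  \sum_(i < size f) ('X^i %% D)`_j *: f`_i.

Lemma ocoord_rem_coef f D j e :
  ocoord e (rem_coef f D j) = (coord_poly f e %% D)`_j.
Proof.
rewrite /coord_poly poly_def.
rewrite (big_morph (fun p => p %% D) (modpD D) (mod0p D)) coef_sum ocoord_sum.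
by apply: eq_bigr => i _; rewrite ocoordZ modpZl coefZ mulrC.
Qed.

(** * Powers modulo Delta: f as an affine map on a class *)

Lemma size2_poly (p : {poly R}) : (size p <= 2)%N -> p = p`_1 *: 'X + (p`_0)%:P.
Proof.
move=> sp; apply/polyP => -[|[|i]]; rewrite !coefE /= ?mulr1 ?mulr0 ?addr0 ?add0r//.
by rewrite nth_default//; apply: leq_trans sp _.
Qed.

Lemma mod_DeltaE p a : p %% Delta a = (p %% Delta a)`_1 *: 'X + ((p %% Delta a)`_0)%:P.
Proof.
by apply: size2_poly; have := ltn_modp p (Delta a); rewrite size_Delta Delta_neq0.
Qed.

Lemma modXS_Delta a i (c := ('X^i %% Delta a)`_1) (d := ('X^i %% Delta a)`_0) :
  'X^(i.+1) %% Delta a = (2 * ore a * c + d) *: 'X + (- (onorm a ^+ 2) * c)%:P.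
Proof.
rewrite exprS -(modp_mul 'X); rewrite (mod_DeltaE 'X^i) -/c -/d.
(* Multiplying the remainder $cX + d$ by $X$ creates only the term $cX^2$ of degree 2, so the
   quotient is the constant [c]. *)
rewrite [X in X %% _](_ : _ = c%:P * Delta a +
  ((2 * ore a * c + d) *: 'X + (- (onorm a ^+ 2) * c)%:P)); last first.
  by rewrite DeltaE -!mul_polyC; ring.
rewrite modp_addl_mul_small// size_Delta ltnS.
rewrite (leq_trans (size_polyD _ _))// geq_max.
rewrite (leq_trans (size_scale_leq _ _)) ?size_polyX//.
by rewrite (leq_trans (size_polyC_leq1 _)).
Qed.

(** The real span of 1 and [w] is stable under left multiplication by [w], and by [omul_self] this
    acts there as multiplication by $X$ does modulo [Delta w]. *)
Lemma opow_mod w i :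
  opow w i = ('X^i %% Delta w)`_1 *: w + ('X^i %% Delta w)`_0 *: octR 1.
Proof.
elim: i => [|i IHi].
  by rewrite expr0 modp_small ?size_Delta ?size_poly1// !coefE scale0r add0r scale1r.
rewrite modXS_Delta /opow iterS -/(opow w i) IHi !coefE /= omulDr !omulZr.
rewrite omul_self octRE omulo1 mulr1 mulr0 addr0 add0r.
rewrite scalerBr !scalerA scalerDl mulNr scaleNr addrAC.
by rewrite [2 * _ * _]mulrC [onorm w ^+ 2 * _]mulrC.
Qed.

(** Only real scalars are moved across products, so non-associativity does no harm. Both
    coefficients depend on [w] through [Delta w] alone, hence are constant on a class. *)
Lemma oeval_class w f :
  oeval f w = omul w (rem_coef f (Delta w) 1) + rem_coef f (Delta w) 0.
Proof.
rewrite (big_morph _ (omulDr w) (omulo0 w)) -big_split /=; apply: eq_bigr => i _.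
by rewrite opow_mod omulDl !omulZl omul1o omulZr.
Qed.

Lemma sum_coord_linear_sqr x y :
  \sum_(e < 8) (ocoord e x *: 'X + (ocoord e y)%:P) ^+ 2 =
  (onorm x ^+ 2) *: 'X^2 + (2 * ore (omul x (oconj y))) *: 'X + (onorm y ^+ 2)%:P.
Proof.
rewrite !onorm_sqr (ore_omul_oconj x x) (ore_omul_oconj x y) (ore_omul_oconj y y).
rewrite -scalerA !scaler_suml scaler_sumr (big_morph _ (@polyCD R) (erefl 0%:P)).
rewrite -!big_split /=; apply: eq_bigr => e _.
by rewrite -!mul_polyC; ring.
Qed.

(** * Zeros in a class versus divisibility of N(f) *)

Lemma dvdp_Npoly_rem f a (A := rem_coef f (Delta a) 1)
    (B := rem_coef f (Delta a) 0) :
  Delta a %| Npoly f <->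
  ore (omul A (oconj B)) = - (ore a * onorm A ^+ 2) /\
  onorm B ^+ 2 = onorm A ^+ 2 * onorm a ^+ 2.
Proof.
have FAB e : coord_poly f e %% Delta a = ocoord e A *: 'X + (ocoord e B)%:P.
  by rewrite {1}mod_DeltaE; congr (_ *: _ + _%:P); rewrite ocoord_rem_coef.
clearbody A B.
(* [M] is $|A|^2X^2 + 2\langle A,B\rangle X + |B|^2$, the sum of the squared remainders, minus
   $|A|^2\Delta_a$. Its two coefficients vanish exactly under the two stated conditions. *)
set M := (2 * (ore (omul A (oconj B)) + ore a * onorm A ^+ 2)) *: 'X +
  (onorm B ^+ 2 - onorm A ^+ 2 * onorm a ^+ 2)%:P.
have sM : (size M < size (Delta a))%N.
  rewrite size_Delta ltnS (leq_trans (size_polyD _ _))// geq_max.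
  rewrite (leq_trans (size_scale_leq _ _)) ?size_polyX//.
  by rewrite (leq_trans (size_polyC_leq1 _)).
have NM : Npoly f %% Delta a = M.
  rewrite NpolyE (big_morph (fun p => p %% Delta a) (modpD _) (mod0p _)).
  transitivity ((\sum_(e < 8) (ocoord e A *: 'X + (ocoord e B)%:P) ^+ 2) %% Delta a).
    rewrite (big_morph (fun p => p %% Delta a) (modpD _) (mod0p _)).
    apply: eq_bigr => e _; rewrite -FAB !expr2 modp_mul.
    by rewrite [_ %% _ * _]mulrC modp_mul.
  rewrite sum_coord_linear_sqr.
  have -> : (onorm A ^+ 2) *: 'X^2 + (2 * ore (omul A (oconj B))) *: 'X +
      (onorm B ^+ 2)%:P = (onorm A ^+ 2)%:P * Delta a + M.
    by rewrite /M DeltaE -!mul_polyC; ring.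
  by rewrite modp_addl_mul_small.
rewrite /dvdp NM /M; split.
  move=> /eqP M0.
  have := congr1 (fun p : {poly R} => p`_0) M0.
  have := congr1 (fun p : {poly R} => p`_1) M0.
  rewrite !coefE /= mulr0 add0r mulr1 addr0 => /eqP.
  rewrite mulf_eq0 pnatr_eq0 /= addr_eq0 => /eqP -> /eqP.
  by rewrite subr_eq0 => /eqP.
by move=> [-> ->]; rewrite addNr mulr0 subrr scale0r addr0.
Qed.

Lemma dvdp_Npoly f a :
  Delta a %| Npoly f <-> exists2 w, conj_class a w & zeros f w.
Proof.
set A := rem_coef f (Delta a) 1; set B := rem_coef f (Delta a) 0.
rewrite dvdp_Npoly_rem -/A -/B.
have fE w : Delta w = Delta a -> oeval f w = omul w A + B.
  by move=> Dw; rewrite oeval_class Dw.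
clearbody A B; split.
  move=> [AB BB]; have [A0|A0] := eqVneq A 0.
    (* Here [B] vanishes too, so every point of the class is a zero. *)
    exists a; first by apply/conj_classP.
    rewrite /zeros /= fE// A0 omulo0 add0r; apply: onorm_eq0.
    by apply/eqP; rewrite -sqrf_eq0 BB A0 onorm_sqr omul0o /ore /= mul0r.
  have nA : onorm A ^+ 2 != 0.
    by rewrite sqrf_eq0; apply: contra_neq A0; exact: onorm_eq0.
  (* This is $-BA^{-1}$, the only solution of $wA + B = 0$; the two conditions give it the real part
     and norm of [a]. *)
  set w := - (onorm A ^+ 2)^-1 *: omul B (oconj A).
  have aw : conj_class a w.
    apply/conj_classP; split.
      rewrite oreZ -ore_oconj oconjM oconjK AB mulrNN mulrCA.
      by rewrite mulVf// mulr1.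
    rewrite onormZ onormM onorm_oconj BB sqrrN; field.
    by apply: contraNneq nA => ->; rewrite expr0n.
  exists w => //; move/conj_class_Delta: aw => aw.
  rewrite /zeros /= fE// omulZl.
  have := omulK B (oconj A); rewrite oconjK onorm_oconj => ->.
  by rewrite scalerA mulNr mulVf// scaleN1r addNr.
move=> [w /[dup] /conj_class_Delta Dw /conj_classP[<- <-]].
rewrite /zeros /= fE// => /eqP; rewrite addrC addr_eq0 => /eqP ->.
split; last by rewrite onormN onormM mulrC.
by rewrite ore_mul_oconjN ore_mul_conj_mul.
Qed.

(** Subtracting the two affine equations gives $(w' - w)A = 0$; the absence of zero divisors kills
    [A], and then [B]. *)
Lemma conj_class_zeros_sub f w w' :
  conj_class w w' -> w' <> w -> zeros f w -> zeros f w' ->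
  rem_coef f (Delta w) 1 = 0 /\ rem_coef f (Delta w) 0 = 0.
Proof.
move=> /conj_class_Delta Dw ww'; rewrite /zeros /= !oeval_class Dw.
move: (rem_coef _ _ 1) (rem_coef _ _ 0) => A B fw fw'.
have A0 : A = 0.
  have : omul (w' - w) A = 0.
    rewrite omulDl -scaleN1r omulZl scaleN1r.
    by apply/eqP; rewrite subr_eq0 -(inj_eq (addIr B)) fw fw'.
  by case/omul_eq0 => // /eqP; rewrite subr_eq0 => /eqP.
by split=> //; move: fw; rewrite A0 omulo0 add0r.
Qed.

Lemma conj_class_zeros f w w' :
  conj_class w w' -> w' <> w -> zeros f w -> zeros f w' ->
  conj_class w `<=` zeros f.
Proof.
move=> ww' neq fw fw' x /conj_class_Delta Dx.
have [A0 B0] := conj_class_zeros_sub f w w' ww' neq fw fw'.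
by rewrite /zeros /= oeval_class Dx A0 B0 omulo0 addr0.
Qed.

Lemma conj_class_refl a : conj_class a a.
Proof. exact/conj_classP. Qed.

Lemma oct_realP a : oct_real a <-> oconj a = a.
Proof.
split=> [[r _ <-]|/oconj_id ->]; last by exists (ore a).
by rewrite octRE; apply: oct_ext; split; rewrite /= /GRing.scale /=; ring.
Qed.

Lemma conj_class_oconj a : conj_class a (oconj a).
Proof. by apply/conj_classP; rewrite ore_oconj onorm_oconj. Qed.

Lemma oct_real_Delta a b : oct_real a -> Delta a = Delta b -> b = a.
Proof.
move=> [r _ <-] Db; apply: root_Delta; rewrite -Db /root Delta_horner oreR subrr.
by rewrite /oim oreR subrr onorm_sqr omul0o /ore /= expr0n addr0.
Qed.

Lemma spherical_dvdp f a :
  spherical_zeros f a -> Delta a ^+ 2 %| Npoly f.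
Proof.
move=> [/oct_realP a_real sub].
(* As [a] is not real, [a] and [oconj a] are two distinct zeros in one class. *)
have [A0 B0] := conj_class_zeros_sub f a (oconj a) (conj_class_oconj a) a_real
  (sub _ (conj_class_refl a)) (sub _ (conj_class_oconj a)).
rewrite NpolyE; apply: (big_ind (fun p => Delta a ^+ 2 %| p)) => [|p q|e _].
- exact: dvdp0.
- exact: dvdp_add.
rewrite dvdp_exp2r// /dvdp mod_DeltaE.
rewrite -(ocoord_rem_coef f _ 1) -(ocoord_rem_coef f _ 0) A0 B0 ocoord0.
by rewrite scale0r addr0.
Qed.

(** * Factoring nonnegative real polynomials into quadratics Delta *)

Lemma horner_gt0_near P r : 0 < P.[r] ->
  exists2 d, 0 < d & forall s, `|s - r| < d -> 0 < P.[s].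
Proof.
move=> P0; have [d d0 Pd] := poly_cont r P P0; exists d => // s /Pd.
by rewrite ltr_distl subrr => /andP[].
Qed.

(** A complex root $z$ of [P] supplies the class. If $z$ is not real, a real remainder $cX + d$
    vanishing at $z$ is 0; if $z$ is real, nonnegativity forces a double root. *)
Lemma nonneg_Delta_dvdp P : (forall r, 0 <= P.[r]) -> size P != 1%N ->
  exists a, Delta a %| P.
Proof.
move=> P_ge0 sP; pose toC := real_complex R.
have /closed_rootP[z] : size (map_poly toC P) != 1%N by rewrite size_map_poly.
case: z => x y; set z := (x +i* y)%C => Pz.
(* The root $z$ read as an octonion, so that [Delta a] vanishes at $z$. *)
pose a : oct R := (((x, y), 0), 0); exists a.
have aE : ore a = x /\ onorm a ^+ 2 = x ^+ 2 + y ^+ 2.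
  by split=> //; rewrite onorm_sqr /ore /=; ring.
have Dz : (map_poly toC (Delta a)).[z] = 0.
  rewrite DeltaE aE.1 aE.2 rmorphD rmorphB /=.
  rewrite map_polyXn map_polyZ map_polyX map_polyC /=.
  rewrite !hornerE /z; apply/eqP; rewrite eq_complex /=.
  by apply/andP; split; apply/eqP; ring.
have Pmod := divp_eq P (Delta a); rewrite mod_DeltaE in Pmod.
rewrite /dvdp mod_DeltaE; move: Pmod.
move: (_ %/ _) ((_ %% _)`_1) ((_ %% _)`_0) => Q c d PE.
have [cy cx] : c * y = 0 /\ c * x + d = 0.
  move: Pz; rewrite /root PE !rmorphD /= rmorphM /= map_polyZ map_polyX map_polyC /=.
  rewrite !hornerD hornerM hornerZ hornerX hornerC Dz mulr0 add0r.
  rewrite /z eq_complex /= => /andP[/eqP u /eqP v].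
  split; [rewrite -v|rewrite -u]; ring.
suff c0 : c = 0 by move: cx; rewrite c0 mul0r add0r => ->; rewrite scale0r addr0.
have [y0|y0] := eqVneq y 0; last first.
  by move/eqP: cy; rewrite mulf_eq0 (negPf y0) orbF => /eqP.
(* P = (X - x) G with G(x) = c changes sign at x unless c = 0. *)
pose G := Q * ('X - x%:P) + c%:P.
have Gx : G.[x] = c by rewrite !hornerE subrr mulr0 add0r.
have PG r : P.[r] = (r - x) * G.[r].
  have dE : d = - (c * x) by apply/eqP; rewrite -addr_eq0 addrC cx.
  rewrite PE dE /G DeltaE aE.1 aE.2 y0.
  rewrite !(hornerD, hornerN, hornerM, hornerZ, hornerXn, hornerX, hornerC); ring.
apply/eqP/negPn/negP; rewrite neq_lt => /orP[c0|c0].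
  have [|e e0 Ge] := @horner_gt0_near (- G) x; first by rewrite hornerN Gx oppr_gt0.
  have := P_ge0 (x + e / 2); have := Ge (x + e / 2).
  rewrite PG (_ : x + e / 2 - x = e / 2); last by ring.
  rewrite gtr0_norm ?divr_gt0// hornerN oppr_gt0 pmulr_rge0 ?divr_gt0// leNgt.
  by move=> -> //; lra.
have [|e e0 Ge] := @horner_gt0_near G x; first by rewrite Gx.
have := P_ge0 (x - e / 2); have := Ge (x - e / 2).
rewrite PG (_ : x - e / 2 - x = - (e / 2)); last by ring.
rewrite normrN gtr0_norm ?divr_gt0// mulNr oppr_ge0 pmulr_rle0 ?divr_gt0// leNgt.
by move=> -> //; lra.
Qed.

(** Dividing values fails where [Delta a] vanishes, so a neighbourhood is used: if [Q] were negative
    at [r], then [Delta a] would be at most 0 at [r] and at a nearby point. The first forces $r =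
    \mathrm{Re}(a)$, and then the second value is positive. *)
Lemma nonneg_divp_Delta Q a :
  (forall r, 0 <= (Q * Delta a).[r]) -> forall r, 0 <= Q.[r].
Proof.
move=> QD_ge0 r; rewrite leNgt; apply/negP => Qr.
have [|d d0 Qd] := @horner_gt0_near (- Q) r; first by rewrite hornerN oppr_gt0.
have D_le0 s : `|s - r| < d -> (Delta a).[s] <= 0.
  move=> /Qd; rewrite hornerN oppr_gt0 => Qs.
  by have := QD_ge0 s; rewrite hornerM nmulr_rge0.
have := D_le0 r; rewrite subrr normr0 => /(_ d0); rewrite Delta_horner => h1.
have := D_le0 (r + d / 2); rewrite (_ : r + d / 2 - r = d / 2); last by ring.
rewrite gtr0_norm ?divr_gt0// Delta_horner => h2.
have hd : d / 2 < d by lra.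
have {hd h2} := h2 hd.
have n0 := sqr_ge0 (onorm (oim a)).
have /eqP : (r - ore a) ^+ 2 = 0.
  by apply/eqP; rewrite eq_le sqr_ge0 andbT; apply: le_trans h1; rewrite lerDl.
rewrite sqrf_eq0 => /eqP r0; rewrite addrAC r0 add0r leNgt ltr_wpDr//.
by rewrite exprn_gt0// divr_gt0.
Qed.

Lemma nonneg_prod_Delta P : (forall r, 0 <= P.[r]) -> P != 0 ->
  exists c (s : seq (oct R)), c != 0 /\ P = c *: \prod_(a <- s) Delta a.
Proof.
have [m] := ubnP (size P); elim: m P => // m IHm P sP P_ge0 P0.
have [/eqP/size_poly1P[c c0 ->]|sP1] := eqVneq (size P) 1%N.
  by exists c, [::]; rewrite big_nil alg_polyC.
have [a /dvdpP[Q PE]] := nonneg_Delta_dvdp P P_ge0 sP1.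
have Q0 : Q != 0 by apply: contraNneq P0 => Q0; rewrite PE Q0 mul0r.
have [|r|c [s [c0 QE]]] := IHm Q _ _ Q0.
- by move: sP; rewrite PE size_Mmonic ?monic_Delta// size_Delta; lia.
- by apply: (nonneg_divp_Delta Q a) => t; rewrite -PE.
- by exists c, (a :: s); rewrite big_cons PE QE mulrC -scalerAr.
Qed.

Lemma size_prod_Delta (s : seq (oct R)) :
  size (\prod_(a <- s) Delta a) = (2 * size s).+1.
Proof.
elim: s => [|a s IHs]; first by rewrite big_nil size_poly1.
rewrite big_cons mulrC size_Mmonic ?monic_Delta// -?size_poly_eq0 IHs//.
by rewrite size_Delta /=; lia.
Qed.

Lemma Delta_mult_prod a (s : seq (oct R)) c
    (m := count (fun b => Delta b == Delta a) s) :
  c != 0 -> let P := c *: \prod_(b <- s) Delta b in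
  Delta a ^+ m %| P /\ ~ (Delta a ^+ m.+1 %| P).
Proof.
move=> c0 /=.
have -> : \prod_(b <- s) Delta b =
    Delta a ^+ m * \prod_(b <- s | Delta b != Delta a) Delta b.
  rewrite (bigID (fun b => Delta b == Delta a)) /=; congr (_ * _).
  rewrite (eq_bigr (fun=> Delta a)) => [|b /eqP//].
  by rewrite big_const_seq iter_mulr_1.
rewrite !dvdpZr // dvdp_mulr//; split=> //.
rewrite exprSr dvdp_mul2l ?expf_neq0 ?Delta_neq0//; move=> Ddvd.
(* One more power of [Delta a] would have to divide the remaining factors, all coprime to it. *)
have : coprimep (Delta a) (\prod_(b <- s | Delta b != Delta a) Delta b).
  apply: (big_ind (coprimep (Delta a))) => [|p q cp cq|b ba]; first exact: coprimep1.
    by rewrite coprimepMr cp.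
  by apply: coprimep_Delta; rewrite eq_sym.
move=> /coprimepP/(_ _ (dvdpp _) Ddvd)/eqp_size.
by rewrite size_Delta size_poly1.
Qed.

(** * Multiplicities and the number of classes of zeros *)

Section ZeroCount.
Variables (n : nat) (f : seq (oct R)).
Hypothesis f_deg : has_degree f n.

Lemma leq_mult a m : (m <= mult f a)%N <-> Delta a ^+ m %| Npoly f.
Proof.
have [dvd ndvd] := multP a f_deg; split=> [le|Dm].
  by apply: dvdp_trans dvd; apply: dvdp_exp2l.
rewrite leqNgt; apply/negP => lt; apply: ndvd.
by apply: dvdp_trans Dm; apply: dvdp_exp2l.
Qed.

Lemma mult_gt0P a : (0 < mult f a)%N <-> exists2 w, conj_class a w & zeros f w.
Proof. by rewrite leq_mult expr1 dvdp_Npoly. Qed.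

Lemma zero_mult_gt0 a : zeros f a -> (0 < mult f a)%N.
Proof. by move=> fa; apply/mult_gt0P; exists a => //; exact: conj_class_refl. Qed.

(** The list [s] indexes the quadratic factors of N(f); it has [n] entries because N(f) has degree
    $2n$. *)
Lemma mult_count : exists s : seq (oct R),
  size s = n /\ forall a, mult f a = count (fun b => Delta b == Delta a) s.
Proof.
have [c [s [c0 NE]]] :=
  nonneg_prod_Delta (Npoly f) (horner_Npoly_ge0 f) (Npoly_neq0 f_deg).
exists s; split=> [|a].
  have := size_Npoly f n f_deg.
  by rewrite NE size_scale// size_prod_Delta; lia.
apply: (is_mult_uniq (multP a f_deg)); rewrite /is_mult NE.
exact: Delta_mult_prod.
Qed.

(** A transversal of the classes that meet V(f). A class is represented by its [Delta], so that
    distinctness and exhaustiveness concern a list of polynomials. *)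
Definition class_reps L :=
  [/\ uniq (map (@Delta R) L), forall a, a \in L -> zeros f a
    & forall w, zeros f w -> Delta w \in map (@Delta R) L].

Lemma class_reps_exist : exists L, class_reps L.
Proof.
have [s [_ mE]] := mult_count.
have in_s a : (0 < mult f a)%N -> Delta a \in map (@Delta R) s.
  by rewrite mE -has_count => /hasP[b bs /eqP <-]; exact: map_f.
pose T := undup (map (@Delta R) s).
(* The default 0 is never taken for [D] in [T]: each factor of N(f) has a zero in its class. *)
pose z D : oct R := xget 0 [set w | zeros f w /\ Delta w = D].
have zP D : D \in T -> zeros f (z D) /\ Delta (z D) = D.
  rewrite mem_undup => /mapP[b bs ->].
  have /mult_gt0P[w /conj_class_Delta bw fw] : (0 < mult f b)%N.
    by rewrite mE -has_count; apply/hasP; exists b.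
  by rewrite /z; case: xgetP => [y _ //|/(_ w)[]].
have DT : map (@Delta R) (map z T) = T.
  by rewrite -map_comp map_id_in// => D /zP[].
exists (map z T); split; rewrite ?DT ?undup_uniq//.
  by move=> a /mapP[D /zP[fD _] ->].
by move=> w /zero_mult_gt0/in_s; rewrite mem_undup.
Qed.

Lemma class_reps_card L : class_reps L ->
  [set conj_class a | a in zeros f] #= `I_(size L).
Proof.
move=> [uL Lf fL].
have -> : [set conj_class a | a in zeros f] =
    [set conj_class (nth 0 L i) | i in `I_(size L)].
  apply/seteqP; split=> _ [w /= h <-].
    have /mapP[a aL Da] := fL _ h; exists (index a L); first by rewrite /= index_mem.
    by rewrite (nth_index 0 aL); apply/eq_conj_class/esym.
  by exists (nth 0 L w); [apply: Lf; apply: mem_nth|].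
apply: inj_card_eq => i j; rewrite !inE /= => iL jL /eq_conj_class ij.
by apply/eqP; rewrite -(nth_uniq 0 _ _ uL) ?size_map// !(nth_map 0)// ij.
Qed.

(** Double counting: each of the [n] factors of N(f) belongs to the class of exactly one entry of
    [L]. *)
Lemma class_reps_sum L : class_reps L -> (\sum_(a <- L) mult f a)%N = n.
Proof.
move=> [uL Lf fL]; have [s [<- mE]] := mult_count.
under eq_bigr do rewrite mE -sum1_count big_mkcond /=.
rewrite exchange_big /= -[RHS]sum1_size; apply: eq_big_seq => b bs.
rewrite -big_mkcond sum1_count /=.
have /mult_gt0P[w /conj_class_Delta bw /fL] : (0 < mult f b)%N.
  by rewrite mE -has_count; apply/hasP; exists b.
rewrite bw => bL; have := count_uniq_mem (Delta b) uL.
rewrite bL count_map => cL; rewrite -[RHS]cL.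
by apply: eq_count => a /=; rewrite eq_sym.
Qed.

Lemma class_reps_size L : class_reps L -> (size L <= n)%N.
Proof.
move=> reps; rewrite -[leqRHS](class_reps_sum L reps) -sum1_size.
have [_ Lf _] := reps.
by rewrite !big_seq; apply: leq_sum => a /Lf /zero_mult_gt0.
Qed.

(** * Listings of real, isolated and spherical zeros *)

(** Sorting [L] by kind works because a real or isolated zero is the only zero in its class, hence
    an entry of [L]; spherical zeros are needed only up to conjugacy. *)
Lemma class_reps_listing L : class_reps L ->
  exists rs us ss : seq (oct R), zero_listing f rs us ss.
Proof.
move=> [uL Lf fL]; have uL' := map_uniq uL.
exists [seq a <- L | `[< oct_real a >]], [seq a <- L | `[< isolated_zeros f a >]],
  [seq a <- L | `[< spherical_zeros f a >]].
split; rewrite ?filter_uniq//.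
- apply/seteqP; split=> [a|a [fa ra]] /=; rewrite mem_filter.
    by move=> /andP[/asboolP ra /Lf fa].
  have /mapP[b bL /(oct_real_Delta _ _ ra) ba] := fL _ fa.
  by rewrite -ba bL andbT; apply/asboolP; rewrite ba.
- apply/seteqP; split=> [a|a /[dup] ia [nra fa nsub]] /=; rewrite mem_filter.
    by move=> /andP[/asboolP].
  have /mapP[b bL Dab] := fL _ fa.
  (* A second zero in the class would make the whole class vanish. *)
  have [ba|ba] := pselect (b = a); last first.
    have ab : conj_class a b by apply/conj_class_Delta/esym.
    by case: nsub; exact: (conj_class_zeros f a b ab ba fa (Lf _ bL)).
  by rewrite -ba bL andbT; apply/asboolP; rewrite ba.
- by move=> a /=; rewrite mem_filter => /andP[/asboolP].
- apply: (@sub_pairwise _ (fun a b => Delta a != Delta b)) => [a b|].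
    apply: contra; rewrite inE => /conj_class_Delta ->; exact: eqxx.
  have := uL; rewrite uniq_pairwise pairwise_map.
  by apply: (subseq_pairwise (filter_subseq _ _)).
apply/seteqP; split=> [a [b /=]|a [nra sub]].
  rewrite mem_filter => /andP[/asboolP[nrb sub] _] /conj_class_Delta ab; split.
    by move=> ra; apply: nrb; rewrite (oct_real_Delta _ _ ra ab).
  by move=> c /conj_class_Delta ca; apply: sub; apply/conj_class_Delta; rewrite ca.
have fa : zeros f a by apply: sub; exact: conj_class_refl.
have /mapP[b bL Dab] := fL _ fa.
exists b; last by apply/conj_class_Delta.
rewrite /= mem_filter bL andbT; apply/asboolP; split.
  by move=> rb; apply: nra; rewrite (oct_real_Delta _ _ rb (esym Dab)).
by move=> c /conj_class_Delta cb; apply: sub; apply/conj_class_Delta; rewrite cb.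
Qed.

(** Distinct entries have distinct classes: a real class is a point, the class of an isolated zero
    contains no other zero, and spherical entries are non-conjugate by assumption. *)
Lemma listing_class_reps rs us ss :
  zero_listing f rs us ss -> class_reps (rs ++ us ++ ss).
Proof.
move=> [urs rsE uus usE ssE ssN ssU].
have rsP a : a \in rs <-> real_zeros f a by rewrite -rsE.
have usP a : a \in us <-> isolated_zeros f a by rewrite -usE.
split.
- rewrite uniq_pairwise pairwise_map !pairwise_cat allrel_catr.
  have rs_neq L : (forall b, b \in L -> ~ oct_real b) ->
      allrel (relpre (@Delta R) [rel x y | x != y]) rs L.
    move=> Lnr; apply/allrelP => a b /rsP[_ ra] /Lnr nrb /=.
    by apply/eqP => /(oct_real_Delta _ _ ra) ba; apply: nrb; rewrite ba.
  apply/and3P; split.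
  + by apply/andP; split; apply: rs_neq => b; [move=> /usP[]|move=> /ssE[]].
  + apply: (@sub_in_pairwise _ (mem rs) [rel x y | x != y]);
      last by rewrite -uniq_pairwise.
      move=> a b /rsP[_ ra] _ /=; apply: contra => /eqP/(oct_real_Delta _ _ ra) ->.
      exact: eqxx.
    exact/allP.
  apply/and3P; split.
  + apply/allrelP => a b /usP[_ _ na] /ssE[_ sb] /=; apply/eqP => ab; apply: na.
    by move=> c /conj_class_Delta ca; apply: sb; apply/conj_class_Delta; rewrite ca.
  + apply: (@sub_in_pairwise _ (mem us) [rel x y | x != y]);
      last by rewrite -uniq_pairwise.
      move=> a b /usP[_ fa na] /usP[_ fb _] /=; apply: contra => /eqP ab.
      have {}ab : conj_class a b by apply/conj_class_Delta/esym.
      have [->|ba] := pselect (b = a); first exact: eqxx.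
      by case: na; exact: (conj_class_zeros f a b ab ba fa fb).
    exact/allP.
  + apply: sub_pairwise ssN => a b /=; apply: contra => /eqP ab.
    by rewrite inE; apply/conj_class_Delta.
- move=> a; rewrite !mem_cat => /or3P[/rsP[]//|/usP[]//|/ssE[_]].
  by apply; exact: conj_class_refl.
move=> w fw; have [rw|nrw] := pselect (oct_real w).
  by apply: map_f; rewrite mem_cat; apply/orP; left; apply/rsP.
have [sw|nsw] := pselect (conj_class w `<=` zeros f); last first.
  by apply: map_f; rewrite !mem_cat; apply/or3P/Or32; apply/usP.
have : spherical_zeros f w by [].
rewrite -ssU => -[a /= ass /conj_class_Delta ->].
by apply: map_f; rewrite !mem_cat ass !orbT.
Qed.

Lemma listing_size_le rs us ss : zero_listing f rs us ss ->
  (size rs + size us + 2 * size ss <= n)%N.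
Proof.
move=> /[dup] lst /listing_class_reps reps.
rewrite -[leqRHS](class_reps_sum _ reps) !big_cat /= addnA.
have le1 L : (forall a, a \in L -> zeros f a) -> (size L <= \sum_(a <- L) mult f a)%N.
  by move=> Lf; rewrite -sum1_size !big_seq; apply: leq_sum => a /Lf /zero_mult_gt0.
have [_ Lf _] := reps.
apply: leq_add; first apply: leq_add.
- by apply: le1 => a ars; apply: Lf; rewrite mem_cat ars.
- by apply: le1 => a aus; apply: Lf; rewrite !mem_cat aus orbT.
have -> : (2 * size ss = \sum_(a <- ss) 2)%N.
  by rewrite big_const_seq iter_addn_0 count_predT.
(* A spherical zero counts at least twice, since [Delta a ^+ 2] divides N(f). *)
rewrite !big_seq; apply: leq_sum => a ass.
apply/leq_mult; apply: spherical_dvdp; exact: (listing_spherical_sub lst).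
Qed.

End ZeroCount.

End Octonions.


Theorem theorem11 (R : realType) (n : nat) (f : seq (oct R)) :
  (0 < n)%N -> has_degree f n ->
  zeros f !=set0 /\
  exists k : nat,
    [/\ [set conj_class a | a in zeros f] #= `I_k,
        (k <= n)%N,
        exists rs us ss : seq (oct R), zero_listing f rs us ss
      & forall rs us ss : seq (oct R), zero_listing f rs us ss ->
          [/\ k = (size rs + size us + size ss)%N,
              (\sum_(a <- rs ++ us ++ ss) mult f a)%N = n
            & (size rs + size us + 2 * size ss <= n)%N]].
Proof.
move=> n_gt0 f_deg; have [L reps] := class_reps_exist R n f f_deg; split.
  (* An empty transversal would make the total multiplicity 0, against [n_gt0]. *)
  case: L reps => [/(class_reps_sum R n f f_deg)|a L [_ Lf _]].
    by rewrite big_nil => n0; rewrite -n0 in n_gt0.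
  by exists a; apply: Lf; rewrite mem_head.
exists (size L); split.
- exact: class_reps_card.
- exact: class_reps_size f_deg _ reps.
- exact: class_reps_listing reps.
move=> rs us ss lst; have reps' := listing_class_reps _ _ _ _ _ lst; split.
(* [L] and the concatenated listing are transversals of the same set of classes, so their sizes
   agree. *)
- apply/card_eq_II; rewrite -addnA -!size_cat.
  apply: card_eq_trans (class_reps_card _ _ _ reps').
  by rewrite card_eq_sym; exact: class_reps_card.
- exact: class_reps_sum f_deg _ reps'.
- exact: listing_size_le f_deg _ _ _ lst.
Qed.
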